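(* Let $\mathcal{R}$ be an rc-poset with rows labeled $1,\dots,n$ and columns labeled $1,\dots,k$. For every $\omega\in\mathfrak{S}_n$ and every $\nu\in\mathfrak{S}_k$ there is a bijection $\Phi:J(\mathcal{R})\to J(\mathcal{R})$ with $\Phi\circ\mathrm{pro}_\nu=\mathrm{row}_\omega\circ\Phi$.
   Context: Let $\Pi=\{(i,j)\in\mathbb{Z}^2 : i\equiv j\pmod 2\}$. An rc-poset is a finite poset $\mathcal{R}$ with a map $\pi:\mathcal{R}\to\Pi$ such that whenever $p_1$ covers $p_2$ and $\pi(p_1)=(i,j)$, then $\pi(p_2)\in\{(i+1,j-1),(i-1,j-1)\}$ (several elements may share a position). The column of $p$ is the first coordinate of $\pi(p)$ and its row the second; the occurring columns lie in $k$ consecutive integers relabeled $1,\dots,k$ in increasing order, and the occurring rows in $n$ consecutive integers relabeled $1,\dots,n$. $J(\mathcal{R})$ is the set of order ideals of $\mathcal{R}$. For $p\in\mathcal{R}$ the toggle $t_p:J(\mathcal{R})\to J(\mathcal{R})$ is: $t_p(I)=I\cup\{p\}$ if $p\notin I$ and all $p'<p$ lie in $I$; $t_p(I)=I\setminus\{p\}$ if $p\in I$ and no $p'>p$ lies in $I$; $t_p(I)=I$ otherwise. Toggles of elements in a common row (or common column) commute, so $r_j=\prod_{p\text{ in row }j}t_p$ and $c_i=\prod_{p\text{ in column }i}t_p$ are well defined. For $\nu\in\mathfrak{S}_k$, $\mathrm{pro}_\nu=c_{\nu(1)}\circ c_{\nu(2)}\circ\cdots\circ c_{\nu(k)}$,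 and for $\omega\in\mathfrak{S}_n$, $\mathrm{row}_\omega=r_{\omega(1)}\circ\cdots\circ r_{\omega(n)}$. *)

(* Defs.v *)
From HB Require Import structures.
From mathcomp Require Export all_boot all_order all_algebra all_fingroup.
From mathcomp Require Import zify.

Set Implicit Arguments.
Unset Strict Implicit.
Unset Printing Implicit Defensive.

Import Order.TTheory.
Local Open Scope order_scope.

Section RcPoset.

Context {d : Order.disp_t} {R : finPOrderType d}.

Definition covers (p1 p2 : R) : Prop :=
  p2 < p1 /\ ~ exists q : R, p2 < q /\ q < p1.

Definition is_rc_poset (pi : R -> int * int) : Prop :=
  (forall p, ((pi p).1 = (pi p).2 %[mod 2])%Z) /\
  (forall p1 p2, covers p1 p2 ->
     pi p2 = ((pi p1).1 + 1, (pi p1).2 - 1)%R \/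
     pi p2 = ((pi p1).1 - 1, (pi p1).2 - 1)%R).

(* The label l in 1, ..., m stands for the integer a + l; since permutations
   act on 'I_m, the label l is represented by the ordinal l - 1. *)
Definition labeled_by (f : R -> int) (a : int) (m : nat) : Prop :=
  forall p, (a + 1 <= f p <= a + m%:Z)%R.

Definition label (a : int) (m : nat) (i : 'I_m) : int := (a + i.+1%:Z)%R.

Definition is_order_ideal (I : {set R}) : bool :=
  [forall p in I, forall q, (q <= p) ==> (q \in I)].

Definition J : Type := {I : {set R} | is_order_ideal I}.

Definition toggle_set (p : R) (I : {set R}) : {set R} :=
  if (p \notin I) && [forall q, (q < p) ==> (q \in I)] then p |: I
  else if (p \in I) && [forall q, (p < q) ==> (q \notin I)] then I :\ p
  else I.

Lemma is_order_idealP (I : {set R}) :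
  reflect (forall p q, p \in I -> q <= p -> q \in I) (is_order_ideal I).
Proof.
apply: (iffP forall_inP) => [idI p q pI qp|idI p pI].
  by move/forallP/(_ q)/implyP: (idI p pI); apply.
by apply/forallP => q; apply/implyP; apply: idI.
Qed.

Lemma toggle_set_ideal (p : R) (I : {set R}) :
  is_order_ideal I -> is_order_ideal (toggle_set p I).
Proof.
move/is_order_idealP => idI; apply/is_order_idealP => x y.
rewrite /toggle_set; case: ifP => [/andP[pNI /forallP below]|_].
  rewrite !inE => /orP[/eqP->|xI] le_y; last by rewrite (idI x y) ?orbT.
  by case: eqVneq => //= ne; move: (below y); rewrite lt_neqAle ne le_y.
case: ifP => [/andP[pI /forallP above]|_]; last exact: idI.
rewrite !inE => /andP[nex xI] le_y; rewrite (idI x y) // andbT.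
apply/eqP => yp; subst y; move: (above x).
by rewrite lt_neqAle eq_sym nex le_y xI.
Qed.

Definition toggle (p : R) (I : J) : J :=
  exist _ (toggle_set p (sval I)) (toggle_set_ideal p (svalP I)).

(* The composite is taken in the enumeration order of R; by [line_toggleE]
   below, any other order gives the same map when f is the row or the column
   of an rc-poset. *)
Definition line_toggle (f : R -> int) (v : int) : J -> J :=
  \big[@comp J J J/id]_(p : R | f p == v) toggle p.

Definition col_toggle (pi : R -> int * int) := line_toggle (fun p => (pi p).1).

Definition row_toggle (pi : R -> int * int) := line_toggle (fun p => (pi p).2).

Definition promotion (pi : R -> int * int) (a : int) (k : nat) (nu : {perm 'I_k}) :
    J -> J :=
  \big[@comp J J J/id]_(i < k) col_toggle pi (label a (nu i)).

Definition rowmotion (pi : R -> int * int) (b : int) (n : nat) (omega : {perm 'I_n}) :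
    J -> J :=
  \big[@comp J J J/id]_(j < n) row_toggle pi (label b (omega j)).

Lemma in_toggle_set (p x : R) (I : {set R}) : is_order_ideal I ->
  (x \in toggle_set p I) =
  (x \in I) (+) ((x == p) && [forall q, ((q < p) ==> (q \in I)) &&
                                        ((p < q) ==> (q \notin I))]).
Proof.
move=> /is_order_idealP idI; rewrite /toggle_set.
have -> : [forall q, ((q < p) ==> (q \in I)) && ((p < q) ==> (q \notin I))] =
    [forall q, (q < p) ==> (q \in I)] && [forall q, (p < q) ==> (q \notin I)].
  apply/forallP/andP => [H|[/forallP H1 /forallP H2] q]; last by rewrite H1 H2.
  by split; apply/forallP => q; case/andP: (H q).
case: (boolP (p \in I)) => pI /=.
  have -> : [forall q, (q < p) ==> (q \in I)].
    by apply/forallP => q; apply/implyP => /ltW; apply: idI.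
  case: ifP => _; rewrite /= ?inE ?andbF ?andbT ?addbF //.
  by case: eqVneq => [->|] /=; rewrite ?pI ?addbF.
have -> : [forall q, (p < q) ==> (q \notin I)].
  apply/forallP => q; apply/implyP => /ltW pq; apply: contra pI => qI.
  exact: idI pq.
case: ifP => _; rewrite ?inE ?andbF ?andbT ?addbF //.
by case: eqVneq => [->|] /=; rewrite ?(negPf pI) ?addbF.
Qed.

Lemma toggleC (p q : R) : ~ covers p q -> ~ covers q p ->
  forall I, toggle p (toggle q I) = toggle q (toggle p I).
Proof.
have between (x y : R) : x < y -> ~ covers y x ->
    exists2 z, x < z & z < y.
  move=> xy ncov; have /existsP[z /andP[]] : [exists z, (x < z) && (z < y)].
    apply/negP => /existsP nz; apply: ncov; split=> // -[z [xz zy]].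
    by apply: nz; exists z; rewrite xz zy.
  by exists z.
pose free p (I : {set R}) :=
  [forall x, ((x < p) ==> (x \in I)) && ((p < x) ==> (x \notin I))].
have stable (x y : R) (I : {set R}) : is_order_ideal I -> x != y ->
    ~ covers x y -> ~ covers y x -> free x (toggle_set y I) = free x I.
  move=> idI nexy nxy nyx.
  have memE z : (z \in toggle_set y I) = (z \in I) (+) ((z == y) && free y I).
    exact: in_toggle_set.
  have [fy|nfy] := boolP (free y I); last first.
    by apply: eq_forallb => z; rewrite memE (negPf nfy) andbF addbF.
  have memNy z : z != y -> (z \in toggle_set y I) = (z \in I).
    by move=> ne; rewrite memE (negPf ne) addbF.
  have [lt_xy|nlt_xy] := boolP (x < y).
    have [z xz zy] := between _ _ lt_xy nyx.
    have zI : z \in I by move/forallP/(_ z)/andP: fy => [/implyP->].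
    have zT : z \in toggle_set y I by rewrite memNy // (lt_eqF zy).
    transitivity false; [|symmetry]; apply/negP => /forallP/(_ z)/andP[_];
      by rewrite xz ?zI ?zT.
  have [lt_yx|nlt_yx] := boolP (y < x).
    have [z yz zx] := between _ _ lt_yx nxy.
    have zI : z \notin I by move/forallP/(_ z)/andP: fy => [_ /implyP->].
    have zT : z \notin toggle_set y I by rewrite memNy // (gt_eqF yz).
    by transitivity false; [|symmetry]; apply/negP => /forallP/(_ z)/andP[];
      rewrite zx /= ?(negPf zI) ?(negPf zT).
  apply: eq_forallb => z; have [->|ne] := eqVneq z y; last by rewrite memNy.
  by rewrite (negPf nlt_xy) (negPf nlt_yx).
move=> npq nqp [I idI]; apply: val_inj => /=.
have [->//|ne] := eqVneq p q.
apply/setP => x; rewrite !in_toggle_set ?toggle_set_ideal //.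
have := stable p q I idI ne npq nqp; rewrite /free => ->.
rewrite eq_sym in ne; have := stable q p I idI ne nqp npq; rewrite /free => ->.
by rewrite -!addbA; congr (_ (+) _); rewrite addbC.
Qed.

Lemma line_toggleE (pi : R -> int * int) (f : R -> int) (v : int) (s : seq R) :
  is_rc_poset pi -> f = (fun p => (pi p).1) \/ f = (fun p => (pi p).2) ->
  uniq s -> s =i [pred p | f p == v] ->
  line_toggle f v =1 \big[@comp J J J/id]_(p <- s) toggle p.
Proof.
move=> [_ rc] fE us sE I.
have comm p q : f p = v -> f q = v ->
    forall I, toggle p (toggle q I) = toggle q (toggle p I).
  have ncov x y : f x = v -> f y = v -> ~ covers x y.
    move=> fx fy /rc; case: fE => fE; move: fx fy; rewrite fE => fx fy [] /= E;
      move/eqP: fy; rewrite E /= fx => /eqP; lia.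
  by move=> fp fq; apply: toggleC; apply: ncov.
have foldE t : (\big[@comp J J J/id]_(p <- t) toggle p) I = foldr toggle I t.
  by elim: t => [|p t IH]; rewrite ?big_nil // big_cons /= IH.
have fs : all (fun p => f p == v) s by apply/allP => p; rewrite sE.
have ps : perm_eq s [seq p <- index_enum R | f p == v].
  apply: uniq_perm => // [|p]; first by rewrite filter_uniq ?index_enum_uniq.
  by rewrite sE mem_filter mem_index_enum andbT.
rewrite foldE /line_toggle -big_filter foldE {us sE foldE}.
move: [seq p <- index_enum R | f p == v] ps => t; elim: s t fs => [|p s IH] t.
  by rewrite perm_sym => _ /perm_nilP->.
move=> /= /andP[/eqP fp fs] ps.
have pt : p \in t by rewrite -(perm_mem ps) mem_head.
case/splitPr: pt ps => t1 t2; rewrite perm_sym perm_catC /= perm_cons perm_catC.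
rewrite perm_sym => ps; rewrite -(IH _ fs ps).
have : all (fun p => f p == v) t1.
  by move: fs; rewrite (perm_all _ ps) all_cat => /andP[].
rewrite !foldr_cat /=; elim: t1 {ps} => //= q t1 IHt /andP[/eqP fq ft].
by rewrite IHt // comm.
Qed.

End RcPoset.

Arguments J {d} R.

(* Main.v *)
(** Toggles at two elements commute unless one of them covers the other, and the
two ends of a cover lie in adjacent rows and adjacent columns.  Hence the row
toggles [r_1, ..., r_n] satisfy [r_i r_j = r_j r_i] whenever [|i - j| > 1], and
likewise for the column toggles.  All products of such a family, each factor
used once, are conjugate whatever the order: cyclic rotation and commutation
bring the last generator next to its only non-commuting neighbour, and the two
are then merged into one.  So [pro_nu] is conjugate to the product of all columns
of one parity followed by all columns of the other, and similarly for
[row_omega].  As the row and the column of an element have the same parity, these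
two products coincide. *)

Require Import Defs.
From mathcomp Require Import zify.

Set Implicit Arguments.
Unset Strict Implicit.
Unset Printing Implicit Defensive.

Import Order.TTheory.

Section CommutingProducts.

Local Open Scope group_scope.

Variable gT : finGroupType.

Lemma prodg_commute (I : eqType) (s : seq I) (F : I -> gT) (x : gT) :
  {in s, forall i, commute x (F i)} -> commute x (\prod_(i <- s) F i).
Proof.
elim: s => [|i s IH] cs; first by rewrite big_nil; apply: commute1.
rewrite big_cons; apply: commuteM; first by apply: cs; rewrite mem_head.
by apply: IH => j js; apply: cs; rewrite inE js orbT.
Qed.

Lemma perm_prodg (I : eqType) (s t : seq I) (F : I -> gT) :
  {in s &, forall i j, commute (F i) (F j)} -> perm_eq s t ->
  \prod_(i <- s) F i = \prod_(i <- t) F i.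
Proof.
elim: s t => [|i s IH] t cs; first by rewrite perm_sym => /perm_nilP->.
move=> pst; have it : i \in t by rewrite -(perm_mem pst) mem_head.
have ct : {in t, forall j, commute (F i) (F j)}.
  by move=> j; rewrite -(perm_mem pst) => js; apply: cs; rewrite ?mem_head.
case/splitPr: it pst ct => t1 t2; rewrite perm_sym perm_catC /= perm_cons.
rewrite perm_catC perm_sym => pst ct; rewrite big_cons (IH _ _ pst); last first.
  by move=> x y xs ys; apply: cs; rewrite inE ?xs ?ys orbT.
rewrite !big_cat big_cons /= !mulgA; congr (_ * _).
by apply: prodg_commute => j jt; apply: ct; rewrite mem_cat jt.
Qed.

(** Undoes the grouping by values of [f], so that products of rows and products of columns can be
    compared. *)
Lemma prodg_fibers (I K : eqType) (E : seq I) (f : I -> K) (F : I -> gT)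
    (s : seq K) : uniq s ->
  {in [pred p | f p \in s] &, forall p q, commute (F p) (F q)} ->
  \prod_(i <- s) \prod_(p <- E | f p == i) F p = \prod_(p <- E | f p \in s) F p.
Proof.
elim: s => [|i s IH] /=; first by rewrite big_nil big_pred0.
case/andP=> nis us cs; rewrite big_cons IH //; last first.
  by move=> p q; rewrite !inE => ps qs; apply: cs; rewrite !inE ?ps ?qs orbT.
rewrite -3!(big_filter E) -big_cat; apply: perm_prodg => [p q|].
  rewrite !mem_cat !mem_filter => Hp Hq; apply: cs; rewrite !inE.
    by case/orP: Hp => /andP[->]; rewrite ?orbT.
  by case/orP: Hq => /andP[->]; rewrite ?orbT.
elim: E {IH} => //= p E IHE; rewrite inE; case: eqVneq => [->|_] /=.
  by rewrite (negPf nis) /= perm_cons.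
case: ifP => // _; rewrite -cat1s perm_catCA /= perm_cons; exact: IHE.
Qed.

(* The Coxeter-element argument for a path; no relation other than commutation
   is needed. *)
Lemma prodg_path_conj (m : nat) (g : nat -> gT) (s : seq nat) :
  (forall i j, i.+1 < j -> j < m -> commute (g i) (g j)) ->
  perm_eq s (iota 0 m) ->
  exists z, \prod_(i <- s) g i = (\prod_(i <- iota 0 m) g i) ^ z.
Proof.
elim: m g s => [|[|m] IH] g s cg ps.
- by exists 1; move/perm_nilP: ps => ->; rewrite conjg1.
- by exists 1; move: ps => /perm_small_eq->; rewrite ?conjg1.
set M := m.+1 in cg ps IH *.
have us : uniq s by rewrite (perm_uniq ps) iota_uniq.
(* Merging the last two generators, in this order, preserves the increasing product and leaves a
   path one vertex shorter. *)
pose h i := if i == m then g m * g M else g i.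
have hM t : m \notin t -> \prod_(i <- t) h i = \prod_(i <- t) g i.
  move=> mt; apply: eq_big_seq => i it; rewrite /h; case: eqP => // im.
  by rewrite -im it in mt.
have ch i j : i.+1 < j -> j < M -> commute (h i) (h j).
  move=> ij jM; rewrite /h ifN; last by lia.
  case: eqP => [jm|_]; last by apply: cg => //; lia.
  by apply: commuteM; apply: cg; lia.
have hiota : \prod_(i <- iota 0 M) h i = \prod_(i <- iota 0 M.+1) g i.
  rewrite -[M.+1]addn1 -[M]addn1 -/M !iotaD !big_cat /= !big_seq1 hM.
    by rewrite /h eqxx addn1 mulgA.
  by rewrite mem_iota; lia.
(* A product with [g M] at its right end absorbs it into [g m]. *)
have absorb t : perm_eq t (iota 0 M) ->
    exists z, \prod_(i <- t) g i * g M = (\prod_(i <- iota 0 M.+1) g i) ^ z.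
  move=> pt; have [z Hz] := IH h t ch pt; exists z; rewrite -hiota -Hz.
  have mt : m \in t by rewrite (perm_mem pt) mem_iota; lia.
  have ut : uniq t by rewrite (perm_uniq pt) iota_uniq.
  have lt_t i : i \in t -> i < M by rewrite (perm_mem pt) mem_iota; lia.
  (* All entries of [t2] are below [m], so [g M] moves left past them until it meets [g m]. *)
  case/splitPr: mt ut lt_t {pt Hz} => t1 t2; rewrite cat_uniq /= negb_or.
  case/and3P=> _ /andP[m1 _] /andP[m2 _] lt_t.
  rewrite !big_cat !big_cons /= !hM // /h eqxx -!mulgA; congr (_ * (_ * _)).
  apply: commute_sym; apply: prodg_commute => i i2; apply: commute_sym.
  have := lt_t i; rewrite mem_cat inE i2 !orbT => /(_ isT) iM.
  have im : i != m by apply: contraNneq m2 => <-.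
  by apply: cg; rewrite /M in iM *; lia.
have Ms : M \in s by rewrite (perm_mem ps) mem_iota; lia.
have lt_s i : i \in s -> i < M.+1 by rewrite (perm_mem ps) mem_iota; lia.
case/splitPr: Ms us lt_s ps => s1 s2 us lt_s ps.
have pt : perm_eq (s1 ++ s2) (iota 0 M).
  rewrite -(perm_cons M) -[M :: s1 ++ s2]cat1s (perm_catCA [:: M] s1 s2).
  by apply: perm_trans ps _; rewrite -addn1 iotaD perm_catC add0n.
have [z Hz] := absorb _ pt.
move: us; rewrite cat_uniq /= negb_or.
case/and3P=> _ /andP[M1 /hasPn dis] /andP[M2 _].
have cM t : {subset t <= s1 ++ M :: s2} -> M \notin t -> m \notin t ->
    commute (g M) (\prod_(i <- t) g i).
  move=> sub Mt mt; apply: prodg_commute => i it; apply: commute_sym.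
  have iM := lt_s i (sub i it).
  have ne1 : i != M by apply: contraNneq Mt => <-.
  have ne2 : i != m by apply: contraNneq mt => <-.
  by apply: cg; rewrite /M in iM ne1 *; lia.
have sub1 : {subset s1 <= s1 ++ M :: s2} by move=> i; rewrite mem_cat => ->.
have sub2 : {subset s2 <= s1 ++ M :: s2}.
  by move=> i i2; rewrite mem_cat inE i2 !orbT.
(* If [m] stands right of [M], then [g M] moves to the front past [s1] and a conjugation by it
   rotates it to the end; otherwise it moves to the end past [s2]. *)
have [m2|m2] := boolP (m \in s2).
  have {}cM := cM _ sub1 M1 (dis _ m2); exists (z * (g M)^-1).
  by rewrite conjgM -Hz conjgE invgK !big_cat big_cons /= !mulgA mulgK -cM.
exists z; rewrite -Hz !big_cat big_cons /= -!mulgA; congr (_ * _).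
exact: cM.
Qed.

End CommutingProducts.

Section TogglePermutations.

Context {d : Order.disp_t} {R : finPOrderType d}.

(** Whether [p] can be toggled depends only on the elements other than [p], which the toggle leaves
    alone. *)
Lemma toggleK (p : R) : involutive (toggle p).
Proof.
move=> [I idI]; apply: val_inj; apply/setP => x /=.
rewrite !in_toggle_set ?toggle_set_ideal // -addbA.
set a := [forall q, _]; set b := [forall q, _].
have -> : a = b; last by rewrite addbb addbF.
apply: eq_forallb => q; rewrite in_toggle_set //.
by case: eqVneq => [->|_]; rewrite ?ltxx //= addbF.
Qed.

Definition toggle_perm (p : R) : {perm (J R)} := perm (can_inj (toggleK p)).

(* [rev] because the product of permutations composes from left to right. *)
Lemma big_comp_perm (T : finType) (I : Type) (s : seq I) (F : I -> T -> T)
    (G : I -> {perm T}) : (forall i, F i =1 G i) ->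
  \big[@comp T T T/id]_(i <- s) F i =1 (\prod_(i <- rev s) G i)%g.
Proof.
move=> FG x; elim: s => [|i s IH]; first by rewrite !big_nil perm1.
by rewrite big_cons rev_cons -cats1 big_cat big_seq1 permM /= IH FG.
Qed.

Definition line_perm (f : R -> int) (v : int) : {perm (J R)} :=
  (\prod_(p <- rev (index_enum R) | f p == v) toggle_perm p)%g.

Lemma line_toggle_perm (f : R -> int) (v : int) :
  line_toggle f v =1 line_perm f v.
Proof.
move=> I; rewrite /line_toggle /line_perm -big_filter -[in RHS]big_filter.
rewrite filter_rev (big_comp_perm _ (G := toggle_perm)) // => p x.
by rewrite permE.
Qed.

(** The conjugated product depends on [pr] alone, not on [f] or [sigma], so rows and columns sharing
    one parity predicate yield conjugates of the same element. *)
Lemma line_product_conj (pr : R -> bool) (f : R -> int) (a : int) (m : nat)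
    (sigma : {perm 'I_m}) :
  (forall p, pr p = ((f p %% 2)%Z == 0)) ->
  (forall p q, covers p q -> f q = (f p + 1)%R \/ f q = (f p - 1)%R) ->
  labeled_by f a m ->
  exists2 P : {perm (J R)},
    \big[@comp (J R) (J R) (J R)/id]_(i < m) line_toggle f (label a (sigma i))
      =1 P &
    exists z, P = ((\prod_(p <- rev (index_enum R) | pr p) toggle_perm p *
                    \prod_(p <- rev (index_enum R) | ~~ pr p) toggle_perm p) ^ z)%g.
Proof.
move=> prE cov lab.
pose lb (i : nat) : int := (a + i.+1%:Z)%R.
pose g i := line_perm f (lb i).
pose s := rev [seq nat_of_ord (sigma i) | i <- index_enum 'I_m].
exists (\prod_(i <- s) g i)%g.
  move=> I; rewrite (big_comp_perm _ (G := fun i => g (sigma i))).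
    by rewrite /s -map_rev big_map.
  by move=> i x; rewrite line_toggle_perm.
have ct p q : f q <> (f p + 1)%R -> f q <> (f p - 1)%R ->
    commute (toggle_perm p) (toggle_perm q).
  move=> n1 n2; apply/permP => I; rewrite !permM !permE; apply: toggleC.
    by move=> /cov; lia.
  by move=> /cov; lia.
have cg i j : i.+1 < j -> j < m -> commute (g i) (g j).
  move=> ij _; rewrite /g /line_perm -!(big_filter (rev _)).
  apply: prodg_commute => q; rewrite mem_filter => /andP[/eqP fq _].
  apply/commute_sym/prodg_commute => p; rewrite mem_filter => /andP[/eqP fp _].
  by apply: ct; rewrite fp fq /lb; lia.
have ps : perm_eq s (iota 0 m).
  rewrite /s perm_rev; apply: uniq_perm; rewrite ?iota_uniq //.
    rewrite map_inj_uniq ?index_enum_uniq // => x y /val_inj; exact: perm_inj.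
  move=> i; rewrite mem_iota /=; apply/mapP/idP => [[j _ ->]|im].
    by rewrite ltn_ord.
  by exists ((sigma^-1)%g (Ordinal im)); rewrite ?mem_index_enum ?permKV.
pose ev i := (lb i %% 2)%Z == 0.
pose t := filter ev (iota 0 m) ++ filter (predC ev) (iota 0 m).
have pt : perm_eq t (iota 0 m) by rewrite /t perm_filterC.
(* The given order and the order by parity are compared through the increasing product. *)
have [z1 E1] := prodg_path_conj cg ps.
have [z2 E2] := prodg_path_conj cg pt.
(* Values of equal parity never differ by one, so by [ct] all toggles of one parity class
   commute. *)
have half (b : bool) :
    (\prod_(i <- [seq i <- iota 0 m | ev i == b]) g i)%g =
    (\prod_(p <- rev (index_enum R) | pr p == b) toggle_perm p)%g.
  pose u := [seq lb i | i <- [seq i <- iota 0 m | ev i == b]].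
  have uE p : (f p \in u) = (pr p == b).
    rewrite prE; apply/mapP/idP => [[i]|].
      by rewrite mem_filter /ev => /andP[/eqP <- _] ->.
    have := lab p; move=> /andP[lo hi] pb.
    (* [labeled_by] makes [f p - a - 1] a natural number below [m], the index of the line through
       [p]. *)
    have E : f p = lb (absz (f p - a - 1)%R) by rewrite /lb; lia.
    by exists (absz (f p - a - 1)%R) => //; rewrite mem_filter /ev -E pb mem_iota; lia.
  transitivity (\prod_(v <- u) line_perm f v)%g; first by rewrite big_map.
  rewrite prodg_fibers; first exact: eq_bigl.
    rewrite map_inj_uniq ?filter_uniq ?iota_uniq // => i j; rewrite /lb; lia.
  by move=> p q; rewrite !inE !uE !prE => /eqP bp /eqP; rewrite -bp => bq; apply: ct; lia.
exists (z2^-1 * z1)%g; rewrite E1 conjgM; congr (_ ^ z1)%g.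
apply: (canRL (conjgK z2)); rewrite -E2 /t big_cat /=.
congr (_ * _)%g.
  transitivity (\prod_(p <- rev (index_enum R) | pr p == true) toggle_perm p)%g.
    by rewrite -half (eq_filter (a2 := ev)) // => i; rewrite eqb_id.
  by apply: eq_bigl => p; rewrite eqb_id.
transitivity (\prod_(p <- rev (index_enum R) | pr p == false) toggle_perm p)%g.
  by rewrite -half (eq_filter (a2 := predC ev)) // => i; rewrite /= eqbF_neg.
by apply: eq_bigl => p; rewrite eqbF_neg.
Qed.

End TogglePermutations.

Theorem theorem5p2 (d : Order.disp_t) (R : finPOrderType d)
    (pi : R -> int * int) (n k : nat) (b a : int) :
  is_rc_poset pi ->
  labeled_by (fun p => (pi p).2) b n ->
  labeled_by (fun p => (pi p).1) a k ->
  forall (omega : {perm 'I_n}) (nu : {perm 'I_k}),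
    exists Phi : J R -> J R,
      bijective Phi /\
      Phi \o promotion pi a nu =1 rowmotion pi b omega \o Phi.
Proof.
move=> [par cov] labr labc omega nu.
pose pr p := ((pi p).1 %% 2)%Z == 0.
have covc p q : covers p q -> (pi q).1 = ((pi p).1 + 1)%R \/ (pi q).1 = ((pi p).1 - 1)%R.
  by case/cov=> ->; [left|right].
have covr p q : covers p q -> (pi q).2 = ((pi p).2 + 1)%R \/ (pi q).2 = ((pi p).2 - 1)%R.
  by case/cov=> ->; right.
have [P PE [y Py]] := line_product_conj (pr := pr) nu (fun p => erefl) covc labc.
have prr p : pr p = (((pi p).2 %% 2)%Z == 0) by rewrite /pr par.
have [Q QE [z Qz]] := line_product_conj omega prr covr labr.
(* [P] and [Q] are the conjugates of one element by [y] and [z]. Permutations multiply from left to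
   right, so the left side applies [P] first. *)
have PQ : (P * (y^-1 * z) = (y^-1 * z) * Q)%g.
  by rewrite Py Qz !conjgE -!mulgA !mulKVg.
exists (y^-1 * z)%g; split; first exact: injF_bij perm_inj.
move=> I /=; rewrite /promotion /rowmotion /col_toggle /row_toggle PE QE.
by rewrite -!permM PQ.
Qed.
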